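(* For every integer $N \geq 3$, the number of quadratic doilies in $\mathcal{W}(2N-1,2)$ is $$D_q(N) = 16\left(\binom{2N}{5}_2 - \binom{N}{5}_2 \prod_{i=1}^{5}\left(2^{N+1-i}+1\right) - \frac{15}{3}\, 2^{2N-8}\binom{N}{4}_2 \prod_{i=1}^{4}\left(2^{N+1-i}+1\right)\right).$$
   Context: Gaussian coefficient: $\binom{n}{k}_q = \prod_{i=1}^{k}\frac{q^{n-k+i}-1}{q^i-1}$ (the number of $k$-dimensional vector subspaces of $\mathbb{F}_q^n$; it is $0$ when $k>n$). $\mathrm{PG}(d,2)$ is the projective space of $\mathbb{F}_2^{d+1}$; its points are the nonzero vectors and its lines the triples $\{a,b,a+b\}$. $\mathcal{W}(2N-1,2)$ is the symplectic polar space whose points are all points of $\mathrm{PG}(2N-1,2)$ (nonzero vectors of $\mathbb{F}_2^{2N}$) and whose subspaces are those totally isotropic for the symplectic form $\sigma(x,y)=\sum_{j=1}^N (x_j y_{N+j}+x_{N+j}y_j)$. Its lines are the triples $\{a,b,a+b\}$ with $a\neq b$ nonzero and $\sigma(a,b)=0$. The doily is the unique generalized quadrangle $\mathrm{GQ}(2,2)$ (15 points, 15 lines, 3 points per line, 3 lines per point, and for each point $p$ not on a line $L$ there is a unique point of $L$ collinear with $p$). A doily in $\mathcal{W}(2N-1,2)$ (an $N$-qubit doily) is a set of 15 points of $\mathcal{W}(2N-1,2)$ together with 15 lines of $\mathcal{W}(2N-1,2)$ on these points, forming an incidence structure isomorphic to the doily, such that two distinct points $a,b$ of it satisfy $\sigma(a,b)=0$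 if and only if they lie on a common line of it. A doily in $\mathcal{W}(2N-1,2)$ is called quadratic if its 15 points span a $\mathrm{PG}(4,2)$ (i.e. a 5-dimensional vector subspace of $\mathbb{F}_2^{2N}$). *)

(* Defs.v *)
From HB Require Import structures.
From mathcomp Require Import all_boot all_order all_algebra.

Set Implicit Arguments.
Unset Strict Implicit.
Unset Printing Implicit Defensive.

Import Order.TTheory GRing.Theory Num.Theory.
Local Open Scope ring_scope.

(* The exponents are integers: for n < k the factor of index i = k - n is 0,
   and so is the whole product. *)
Definition gauss_binom (q : rat) (n k : nat) : rat :=
  \prod_(1 <= i < k.+1)
    ((q ^ (n%:Z - k%:Z + i%:Z) - 1) / (q ^ i%:Z - 1)).

(* In a vector of length N + N, the coordinate x_j is at lshift N j and the
   coordinate x_{N+j} at rshift N j. *)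
Definition sigma (N : nat) (x y : 'rV['F_2]_(N + N)) : 'F_2 :=
  \sum_(j < N) (x 0 (lshift N j) * y 0 (rshift N j) +
                x 0 (rshift N j) * y 0 (lshift N j)).

Definition W_points (N : nat) : {set 'rV['F_2]_(N + N)} :=
  [set x | x != 0].

Definition W_lines (N : nat) : {set {set 'rV['F_2]_(N + N)}} :=
  [set [set ab.1; ab.2; ab.1 + ab.2] |
    ab : 'rV['F_2]_(N + N) * 'rV['F_2]_(N + N) &
    [&& ab.1 \in W_points N, ab.2 \in W_points N,
        ab.1 != ab.2 & sigma ab.1 ab.2 == 0]].

Definition collinear (T : finType) (L : {set {set T}}) (a b : T) : bool :=
  [exists l in L, (a \in l) && (b \in l)].

(* GQ(2,2) is unique up to isomorphism, so a point-line structure (P, L) is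
   isomorphic to the doily exactly when it satisfies the defining axioms.
   That two points lie on at most one common line is a consequence of the
   last axiom: a third point d of a second line through a, b in l would be
   collinear with both a and b. *)
Definition is_GQ22 (T : finType) (P : {set T}) (L : {set {set T}}) : bool :=
  [&& #|P| == 15,
      #|L| == 15,
      [forall l in L, (l \subset P) && (#|l| == 3)],
      [forall p in P, #|[set l in L | p \in l]| == 3] &
      [forall p in P, forall l in L,
        (p \notin l) ==> (#|[set q in l | collinear L p q]| == 1)]].

Definition is_doily_of_W (N : nat) (P : {set 'rV['F_2]_(N + N)})
    (L : {set {set 'rV['F_2]_(N + N)}}) : bool :=
  [&& P \subset W_points N,
      L \subset W_lines N,
      is_GQ22 P L &
      [forall a in P, forall b in P,
        (a != b) ==> ((sigma a b == 0) == collinear L a b)]].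

Definition spans_PG4 (N : nat) (P : {set 'rV['F_2]_(N + N)}) : bool :=
  \dim <<enum P>>%VS == 5.

Definition quadratic_doilies (N : nat) :
    {set {set 'rV['F_2]_(N + N)} * {set {set 'rV['F_2]_(N + N)}}} :=
  [set D | is_doily_of_W D.1 D.2 && spans_PG4 D.1].

(* Main.v *)
(* Call a frame a 5-tuple (u_1, ..., u_5) whose pairs with sigma = 1 are the
   edges of a 5-cycle and whose sum is nonzero.  The Gram matrix of a 5-cycle
   over F_2 has rank 4 and radical spanned by the all-ones vector, so a frame is
   linearly independent.  It lies in a unique doily, formed by the zeros of the
   quadratic form with Q(u_i) = 0 that polarizes to sigma; conversely a quadratic
   doily contains exactly 720 frames (its automorphism group S_6 acts regularly
   on them).  With q = 4^N, choosing the vectors of a frame one at a time gives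
   (q - 1) (q/2) (q/4 - 1) (q/8) (q/16 - 1) frames, and dividing by 720 gives
   the stated number, by a polynomial identity in 2^N.

   Facts about a single doily are computed in the model where a point is the
   mask of its coordinates in a frame. *)
Require Import Defs.
From HB Require Import structures.
From mathcomp Require Import all_boot all_order all_algebra.
From mathcomp Require Import ring.

Set Implicit Arguments.
Unset Strict Implicit.
Unset Printing Implicit Defensive.

Import Order.TTheory GRing.Theory Num.Theory.
Local Open Scope ring_scope.

(** * Counting in finite sets *)

Lemma card_seq_filter (T : finType) (s : seq T) (a : pred T) :
  uniq s -> #|[set x in [set y in s] | a x]| = count a s.
Proof.
move=> us; rewrite -size_filter -(card_uniqP (filter_uniq a us)).
by apply: eq_card => x; rewrite !inE mem_filter andbC.
Qed.

Lemma card_seq_set (T : finType) (s : seq T) :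
  uniq s -> #|[set x in s]| = size s.
Proof. by move=> us; rewrite cardsE; apply/card_uniqP. Qed.

(** Fibration over [A] with fibres of constant size. The size [r] lives in a semiring so that it can
    be a rational expression such as [q / 2]. *)
Lemma card_dep_pair (R : pzSemiRingType) (S T : finType) (A : {set S})
    (Q : S -> pred T) (r : R) :
  (forall x, x \in A -> #|[set y | Q x y]|%:R = r) ->
  #|[set p : S * T | (p.1 \in A) && Q p.1 p.2]|%:R = #|A|%:R * r.
Proof.
move=> Qr; have -> : #|[set p : S * T | (p.1 \in A) && Q p.1 p.2]|
    = (\sum_(x in A) #|[set y | Q x y]|)%N.
  rewrite -sum1dep_card -(pair_big_dep (fun x => x \in A) Q (fun _ _ =>
    1%N)) /=.
  by apply: eq_bigr => x _; rewrite sum1dep_card.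
rewrite natr_sum (eq_bigr (fun=> r)) => [|x /Qr //].
by rewrite sumr_const mulr_natl.
Qed.

(** * The model of a doily on masks of length 5 *)

Definition mask_xor (m1 m2 : bitseq) : bitseq :=
  [seq p.1 (+) p.2 | p <- zip m1 m2].

(** The scalar product over F_2 of two bit strings of the same length. *)
Definition parity (m r : bitseq) : bool := foldr addb false (mask m r).

Definition gram (T : Type) (f : T -> T -> bool) (t : seq T) : seq bitseq :=
  [seq [seq f x y | y <- t] | x <- t].

(* Nonzero values of sigma on a frame: the 5-cycle 0-1-4-2-3-0.  This labelling
   makes the conditions on each successive vector of a frame independent. *)
Definition cycle_edges : seq (nat * nat) :=
  [:: (0, 1); (0, 3); (1, 4); (2, 3); (2, 4)]%N.

Definition cycle_gram : seq bitseq :=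
  gram (fun i j => ((i, j) \in cycle_edges) || ((j, i) \in cycle_edges))
    (iota 0 5).

(** The alternating bilinear form with Gram matrix [cycle_gram]. *)
Definition polar (m1 m2 : bitseq) : bool :=
  parity m1 [seq parity m2 r | r <- cycle_gram].

Definition masks5 : seq bitseq :=
  iter 5 (fun s => [seq b :: m | b <- [:: false; true], m <- s]) [:: [::]].

(** The nonzero zeros of the quadratic form that sums [m_i m_j] over the edges: [behead] drops the
    zero mask, which [masks5] lists first. The all-ones mask contains all five edges, hence is not
    singular. *)
Definition singular_masks : seq bitseq :=
  [seq m <- behead masks5 |
    ~~ odd (count (fun e => nth false m e.1 && nth false m e.2) cycle_edges)].

(** Three singular masks with sum zero are pairwise orthogonal, so they form a line. A mask outside
    [singular_masks] has index 15, hence the sentinel 15 forces the third mask inside; increasing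
    indices list each line once. *)
Definition line_masks : seq (seq bitseq) :=
  [seq t <- [seq [:: m1; m2; mask_xor m1 m2]
            | m1 <- singular_masks, m2 <- singular_masks] |
    sorted ltn (rcons [seq index m singular_masks | m <- t] 15%N)].

Definition unit_masks : seq bitseq := gram eq_op (iota 0 5).

Definition extend_frames (s : seq (seq bitseq)) : seq (seq bitseq) :=
  [seq f <- [seq rcons t m | t <- s, m <- singular_masks] |
    [seq polar m1 (last [::] f) | m1 <- take (size f).-1 f]
      == take (size f).-1 (nth [::] cycle_gram (size f).-1)].

Definition mask_frames : seq (seq bitseq) := iter 5 extend_frames [:: [::]].

Lemma mem_extend_frames s t m :
  (rcons t m \in extend_frames s) =
  [&& t \in s, m \in singular_masks &
    [seq polar m1 m | m1 <- t] == take (size t) (nth [::] cycle_gram (size t))].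
Proof.
rewrite mem_filter last_rcons size_rcons succnK -cats1 take_size_cat // cats1
  andbC.
rewrite andbA; congr (_ && _); apply/idP/idP.
  by case/allpairsP=> [[t' m'] /= [ts mM /rcons_inj[-> ->]]]; rewrite ts.
by case/andP=> ts mM; apply/allpairsP; exists (t, m).
Qed.

Lemma mask_frames_uniq : uniq mask_frames.
Proof.
rewrite /mask_frames; elim: 5%N => // n IHn; rewrite iterS.
apply/filter_uniq/allpairs_uniq => //.
by move=> [t m] [t' m'] _ _ /= /rcons_inj.
Qed.

Lemma size_mask_frames : size mask_frames = 720%N.
Proof. by vm_compute. Qed.

(** The extension steps test only the Gram entries against earlier masks; that the rest of the
    matrix is right is computed on the finished list. *)
Lemma mem_mask_frames a b c d e :
  ([:: a; b; c; d; e] \in mask_frames) =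
  all (mem singular_masks) [:: a; b; c; d; e]
    && (gram polar [:: a; b; c; d; e] == cycle_gram).
Proof.
have gramP : all (fun f => all (mem singular_masks) f
    && (gram polar f == cycle_gram)) mask_frames by vm_compute.
apply/idP/idP => [/(allP gramP)//|].
have -> : [:: a; b; c; d; e] = rcons (rcons (rcons (rcons (rcons [::] a) b) c)
  d) e by [].
rewrite /mask_frames 5!iterS !mem_extend_frames /=.
rewrite [cycle_gram]/= !eqseq_cons !eqxx !andbT.
case/andP=> /and5P[-> -> -> -> ->].
case/and5P=> /and5P[_ /eqP-> /eqP-> /eqP-> /eqP->] /and5P[_ _ /eqP-> /eqP->
  /eqP->].
by case/and5P=> _ _ _ /eqP-> /eqP-> /and5P[_ _ _ _ /eqP->].
Qed.

Lemma mask_frames_size : {in mask_frames, forall f : seq bitseq, size f = 5%N}.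
Proof.
have /allP size5 : all (fun f => size f == 5%N) mask_frames by vm_compute.
by move=> f /size5/eqP.
Qed.

(** * Points and lines of the model, checked by computation *)

Definition signature (m : bitseq) : bitseq := [seq parity m r | r <-
  cycle_gram].

Definition collinear_masks (m1 m2 : bitseq) : bool :=
  has (fun t => (m1 \in t) && (m2 \in t)) line_masks.

(** Masks with equal signatures differ by an element of the radical, that is, by zero or the
    all-ones mask; adding the latter changes the value of the quadratic form. *)
Lemma signature_inj : {in singular_masks &, injective signature}.
Proof.
have /allP sep : all (fun m1 => all (fun m2 =>
    (signature m1 == signature m2) ==> (m1 == m2)) singular_masks)
      singular_masks.
  by vm_compute.
by move=> m1 m2 /sep/allP sep1 /sep1/implyP sep2 /eqP/sep2/eqP.
Qed.

Lemma signature_neq0 : {in singular_masks, forall m, true \in signature m}.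
Proof. by apply/allP; vm_compute. Qed.

Lemma line_masks_singular :
  {in line_masks, forall t : seq bitseq, {subset t <= singular_masks}}.
Proof.
have /allP sub : all (all (mem singular_masks)) line_masks by vm_compute.
by move=> t /sub/allP.
Qed.

(** Lines are listed in a fixed order of the masks, so a list is recovered from its set. *)
Lemma line_masks_inj :
  {in line_masks &, forall t1 t2 : seq bitseq, {subset t1 <= t2} -> t1 = t2}.
Proof.
have /allP sep : all (fun t1 => all (fun t2 => all (mem t2) t1 ==> (t1 == t2))
  line_masks) line_masks by vm_compute.
by move=> t1 t2 /sep/allP sep1 /sep1/implyP sep2 /allP/sep2/eqP.
Qed.

Lemma line_masks_uniq : {in line_masks, forall t : seq bitseq, uniq t}.
Proof. by apply/allP; vm_compute. Qed.

Lemma line_masks_size : {in line_masks, forall t : seq bitseq, size t = 3%N}.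
Proof.
have /allP size3 : all (fun t => size t == 3%N) line_masks by vm_compute.
by move=> t /size3/eqP.
Qed.

Lemma count_line_masks :
  {in singular_masks, forall m : bitseq, count (fun t =>
    m \in t) line_masks = 3%N}.
Proof.
have /allP count3 : all (fun m => count (fun t => m \in t) line_masks == 3)%N
  singular_masks by vm_compute.
by move=> m /count3/eqP.
Qed.

Lemma count_collinear_masks (m : bitseq) (t : seq bitseq) :
  m \in singular_masks -> t \in line_masks -> m \notin t ->
  count (collinear_masks m) t = 1%N.
Proof.
have /allP count1 : all (fun m => all (fun t => (m \notin t) ==>
    (count (collinear_masks m) t == 1)%N) line_masks) singular_masks.
  by vm_compute.
by move=> /count1/allP count1m /count1m/implyP count1mt /count1mt/eqP.
Qed.

Lemma line_masksE (t : seq bitseq) : t \in line_masks ->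
  exists m1 m2, [/\ t = [:: m1; m2; mask_xor m1 m2], m1 != m2,
                    size m1 = size m2 & ~~ polar m1 m2].
Proof.
have /allP sum3 : all (fun t => [&& t == [:: nth [::] t 0; nth [::] t 1;
      mask_xor (nth [::] t 0) (nth [::] t 1)], nth [::] t 0 != nth [::] t 1,
      size (nth [::] t 0) == size (nth [::] t 1)
      & ~~ polar (nth [::] t 0) (nth [::] t 1)]) line_masks by vm_compute.
move=> /sum3/and4P[/eqP et m12 /eqP s12 p12].
by exists (nth [::] t 0), (nth [::] t 1).
Qed.

Lemma collinear_masksE (m1 m2 : bitseq) :
  m1 \in singular_masks -> m2 \in singular_masks -> m1 != m2 ->
  collinear_masks m1 m2 = ~~ polar m1 m2.
Proof.
have /allP perp : all (fun m1 => all (fun m2 => (m1 != m2) ==>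
    (collinear_masks m1 m2 == ~~ polar m1 m2)) singular_masks) singular_masks.
  by vm_compute.
by move=> /perp/allP perp1 /perp1/implyP perp2 /perp2/eqP.
Qed.

Lemma mem_line_masks (m1 m2 : bitseq) :
  m1 \in singular_masks -> m2 \in singular_masks -> m1 != m2 ->
  ~~ polar m1 m2 ->
  size m1 = size m2 /\
  exists2 t, t \in line_masks & t =i [:: m1; m2; mask_xor m1 m2].
Proof.
have /allP lines : all (fun m1 => all (fun m2 =>
    (m1 != m2) && ~~ polar m1 m2 ==> (size m1 == size m2) &&
    has (perm_eq [:: m1; m2; mask_xor m1 m2]) line_masks)
    singular_masks) singular_masks by vm_compute.
move=> /lines/allP lines1 /lines1/implyP lines2 m12 p12.
have := lines2; rewrite m12 p12 => /(_ isT)/andP[/eqP s12 /hasP[t tL /perm_mem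
  e]].
by split=> //; exists t => // m; rewrite e.
Qed.

Lemma unit_masks_singular : {subset unit_masks <= singular_masks}.
Proof. by apply/allP; vm_compute. Qed.

(** Each signature bit adds the bits at the two neighbours of a vertex. If all vanish, bits two
    steps apart agree, and steps of two visit the whole 5-cycle. *)
Lemma signature_eq0 (m : bitseq) : size m = 5%N -> true \notin signature m ->
  m = nseq 5 false \/ m = nseq 5 true.
Proof.
case: m => [|b1 [|b2 [|b3 [|b4 [|b5 []]]]]] // _.
by move: b1 b2 b3 b4 b5 => [] [] [] [] [] //; [right | left].
Qed.

Definition line_closure (s : seq bitseq) : seq bitseq :=
  s ++ [seq mask_xor p.1 p.2 |
         p <- [seq (m1, m2) | m1 <- s, m2 <- s] &
         (p.1 != p.2) && ~~ polar p.1 p.2].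

(** Every point of the model is reached from the frame by completing lines twice; hence a frame
    determines the doily that contains it. *)
Lemma line_closure_unit_masks :
  {subset singular_masks <= iter 2 line_closure unit_masks}.
Proof. by apply/allP; vm_compute. Qed.

Definition seq5 (T : Type) (t : T * T * T * T * T) : seq T :=
  let: (a, b, c, d, e) := t in [:: a; b; c; d; e].

(** * The symplectic form over F_2 *)

Local Notation vec N := 'rV['F_2]_(N + N).

(** The form as a boolean: sums become exclusive ors, and Gram matrices can be compared with
    [cycle_gram]. *)
Definition nonperp (N : nat) (x y : vec N) : bool := sigma x y != 0.

Arguments nonperp {N} x y.

Lemma F2_cases (a : 'F_2) : a = 0 \/ a = 1.
Proof. by case: a => [[|[|n]] lt_n]; [left; apply/val_inj|right;
  apply/val_inj|]. Qed.

Lemma F2_add_neq0 (a b : 'F_2) : (a + b != 0) = (a != 0) (+) (b != 0).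
Proof.
have [-> | ->] := F2_cases a; first by rewrite add0r eqxx.
by have [-> | ->] := F2_cases b; rewrite ?addr0 oner_eq0 ?eqxx.
Qed.

Lemma addF2xx (n : nat) (x : 'rV['F_2]_n) : x + x = 0.
Proof. by apply/rowP => i; rewrite !mxE; case: (F2_cases (x 0 i)) => ->;
  apply/val_inj. Qed.

Lemma addF2K (n : nat) (x y : 'rV['F_2]_n) : x + y + y = x.
Proof. by rewrite -addrA addF2xx addr0. Qed.

Lemma addF2_eq0 (n : nat) (x y : 'rV['F_2]_n) : (x + y == 0) = (x == y).
Proof. by apply/eqP/eqP => [e|->]; [rewrite -[x](addF2K _ y) e add0r | rewrite
  addF2xx]. Qed.

Lemma sigmaC (N : nat) (x y : vec N) : sigma x y = sigma y x.
Proof. by apply: eq_bigr => j _; rewrite addrC mulrC [X in _ + X]mulrC. Qed.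

Lemma sigmaDl (N : nat) (x y z : vec N) :
  sigma (x + y) z = sigma x z + sigma y z.
Proof. by rewrite -big_split; apply: eq_bigr => j _; rewrite !mxE /=; ring. Qed.

Lemma nonperpC (N : nat) (x y : vec N) : nonperp x y = nonperp y x.
Proof. by rewrite /nonperp sigmaC. Qed.

Lemma nonperpDl (N : nat) (x y z : vec N) :
  nonperp (x + y) z = nonperp x z (+) nonperp y z.
Proof. by rewrite /nonperp sigmaDl F2_add_neq0. Qed.

Lemma nonperpDr (N : nat) (x y z : vec N) :
  nonperp x (y + z) = nonperp x y (+) nonperp x z.
Proof. by rewrite nonperpC nonperpDl !(nonperpC x). Qed.

Lemma nonperpxx (N : nat) (x : vec N) : nonperp x x = false.
Proof.
rewrite /nonperp /sigma big1 ?eqxx // => j _.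
by case: (F2_cases (x 0 (lshift N j))) => ->;
  case: (F2_cases (x 0 (rshift N j))) => ->; apply/val_inj.
Qed.

Lemma nonperp0r (N : nat) (x : vec N) : nonperp x 0 = false.
Proof. by rewrite -(addF2xx x) nonperpDr addbb. Qed.

Lemma nonperp_neq0r (N : nat) (x y : vec N) : nonperp x y -> y != 0.
Proof. by apply: contraTneq => ->; rewrite nonperp0r. Qed.

(** A nonzero coordinate of [x] is detected by the unit vector at its paired coordinate. *)
Lemma nonperp_nondegenerate (N : nat) (x : vec N) :
  x != 0 -> exists y, nonperp x y.
Proof.
move=> x0; have [i xi] : exists i, x 0 i != 0.
  apply/existsP; apply: contraNT x0; rewrite negb_exists => /forallP x0.
  by apply/eqP/rowP => i; rewrite mxE; apply/eqP; rewrite -[_ == _]negbK x0.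
have e0 (j k : 'I_N) : (lshift N j == rshift N k) = false.
  by apply/negP => /eqP/(congr1 val) /= e; move: (ltn_ord j);
    rewrite e ltnNge leq_addr.
case: (split_ordP i) xi => j -> xj.
  exists (delta_mx 0 (rshift N j)); rewrite /nonperp /sigma (bigD1 j) //= big1.
    by rewrite !mxE !eqxx e0 /= mulr1 mulr0 !addr0.
  move=> k kj; rewrite !mxE !eqxx e0 /= (inj_eq (@rshift_inj _ _)) (negbTE kj).
  by rewrite !mulr0 addr0.
exists (delta_mx 0 (lshift N j)); rewrite /nonperp /sigma (bigD1 j) //= big1.
  by rewrite !mxE !eqxx [rshift _ _ == _]eq_sym e0 /= mulr1 mulr0 add0r addr0.
move=> k kj; rewrite !mxE !eqxx [rshift _ _ == _]eq_sym e0 /=.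
by rewrite (inj_eq (@lshift_inj _ _)) (negbTE kj) !mulr0 addr0.
Qed.

(* Translation by [y] swaps the two halves of [A] cut out by [nonperp a]. *)
Lemma card_nonperp_half (R : numFieldType) (N : nat) (A : pred (vec N)) (a y :
  vec N) (b : bool) :
  (forall x, A (x + y) = A x) -> nonperp a y ->
  #|[set x | A x && (nonperp a x == b)]|%:R = #|[set x | A x]|%:R / 2 :> R.
Proof.
move=> Ay ay.
have half (c : bool) : (#|[set x | A x && (nonperp a x == c)]|
    <= #|[set x | A x && (nonperp a x == ~~ c)]|)%N.
  rewrite -(card_imset _ (addIr y)); apply/subset_leq_card/subsetP => z.
  case/imsetP=> x; rewrite !inE => /andP[Ax /eqP ax] ->.
  by rewrite Ay Ax nonperpDr ax ay addbT /=.
have e : #|[set x | A x]| = (#|[set x | A x && (nonperp a x == b)]| * 2)%N.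
  rewrite -(cardsID [set x | nonperp a x == b]) muln2 -addnn.
  have -> : [set x | A x] :&: [set x | nonperp a x == b]
      = [set x | A x && (nonperp a x == b)] by apply/setP => x; rewrite !inE.
  have -> : [set x | A x] :\: [set x | nonperp a x == b]
      = [set x | A x && (nonperp a x == ~~ b)].
    by apply/setP => x; rewrite !inE andbC; case: (nonperp a x) b => -[].
  congr (_ + _)%N; apply/eqP; rewrite eqn_leq half andbT.
  by have := half (~~ b); rewrite negbK.
by rewrite e natrM mulfK // pnatr_eq0.
Qed.

(** * The doily generated by a frame *)

Definition comb (N : nat) (c : seq (vec N)) (m : bitseq) : vec N :=
  \sum_(x <- mask m c) x.

Definition doily_points (N : nat) (c : seq (vec N)) : {set vec N} :=
  [set x in [seq comb c m | m <- singular_masks]].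

Definition doily_lines (N : nat) (c : seq (vec N)) : {set {set vec N}} :=
  [set l in [seq [set x in [seq comb c m | m <- t]] | t <- line_masks]].

Lemma comb_xor (N : nat) (c : seq (vec N)) (m1 m2 : bitseq) :
  size m1 = size m2 -> comb c (mask_xor m1 m2) = comb c m1 + comb c m2.
Proof.
rewrite /comb; elim: m1 m2 c => [|b1 m1 IHm] [|b2 m2] c //.
  by rewrite /= !big_nil addr0.
move=> -[eqm]; case: c => [|x c]; first by rewrite /= !big_nil addr0.
have := IHm m2 c eqm.
case: b1 b2 => [] [] /= e; rewrite ?big_cons e //.
- by rewrite addrACA addF2xx add0r.
- by rewrite addrA.
by rewrite addrCA.
Qed.

Lemma nonperp_combr (N : nat) (c : seq (vec N)) (m : bitseq) (x : vec N) :
  nonperp x (comb c m) = parity m [seq nonperp x y | y <- c].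
Proof.
rewrite /comb /parity; elim: c m => [|y c IHc] [|[] m] //=;
  by rewrite ?big_nil ?nonperp0r // big_cons nonperpDr IHc.
Qed.

Lemma mem_doily_points (N : nat) (c : seq (vec N)) (x : vec N) :
  reflect (exists2 m, m \in singular_masks & x = comb c m)
    (x \in doily_points c).
Proof. by rewrite inE; apply: mapP. Qed.

Lemma mem_doily_lines (N : nat) (c : seq (vec N)) (l : {set vec N}) :
  reflect (exists2 t, t \in line_masks & l = [set x in [seq comb c m | m <- t]])
    (l \in doily_lines c).
Proof. by rewrite inE; apply: mapP. Qed.

(** Turns linear relations over F_2 into masks, for the proof that frames are free. *)
Lemma comb_scale (N : nat) (c : seq (vec N)) (k : 'I_(size c) -> 'F_2) :
  comb c [seq k i != 0 | i <- enum 'I_(size c)] = \sum_i k i *: c`_i.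
Proof.
rewrite /comb; elim: c k => [|x c IHc] k; first by rewrite mask0 big_ord0
  big_nil.
rewrite /= enum_ordSl big_ord_recl /= -map_comp -(IHc (fun i =>
  k (lift ord0 i))).
by have [-> | ->] := F2_cases (k ord0); rewrite ?big_cons ?scale1r // scale0r
  add0r.
Qed.

Section Frame.

Variables (N : nat) (c : seq (vec N)).
Hypothesis c_gram : gram nonperp c = cycle_gram.

Let size_c : size c = 5%N.
Proof. by have /(congr1 size) := c_gram; rewrite size_map. Qed.

Lemma nonperp_frame_comb (m : bitseq) :
  [seq nonperp x (comb c m) | x <- c] = signature m.
Proof.
rewrite /signature -c_gram /gram -map_comp; apply: eq_map => x /=.
exact: nonperp_combr.
Qed.

Lemma nonperp_comb (m1 m2 : bitseq) :
  nonperp (comb c m1) (comb c m2) = polar m1 m2.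
Proof.
rewrite nonperpC nonperp_combr /polar -/(signature m2) -nonperp_frame_comb.
by congr parity; apply: eq_map => x; apply: nonperpC.
Qed.

(** The products of a vector with the frame form the signature of its mask, and signatures separate
    singular masks. *)
Lemma comb_inj : {in singular_masks &, injective (comb c)}.
Proof.
move=> m1 m2 m1M m2M e; apply: signature_inj => //.
by rewrite -!nonperp_frame_comb e.
Qed.

Lemma comb_neq0 (m : bitseq) : m \in singular_masks -> comb c m != 0.
Proof.
move=> /signature_neq0; rewrite -nonperp_frame_comb => /mapP[x _].
by move/esym/nonperp_neq0r.
Qed.

Lemma uniq_comb (t : seq bitseq) :
  {subset t <= singular_masks} -> uniq [seq comb c m | m <- t] = uniq t.
Proof. by move=> tM; apply: map_inj_in_uniq; apply: sub_in2 comb_inj. Qed.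

Lemma mem_comb (t : seq bitseq) (m : bitseq) :
  {subset t <= singular_masks} -> m \in singular_masks ->
  (comb c m \in [seq comb c m' | m' <- t]) = (m \in t).
Proof.
move=> tM mM; apply/mapP/idP => [[m' m't /comb_inj -> //]|]; last by exists m.
exact: tM.
Qed.

Lemma uniq_doily_lines :
  uniq [seq [set x in [seq comb c m | m <- t]] | t <- line_masks].
Proof.
rewrite map_inj_in_uniq; first by vm_compute.
move=> t1 t2 t1L t2L /setP e; apply: line_masks_inj => // m mt1.
have mM := line_masks_singular t1L mt1.
have := e (comb c m); rewrite !inE !mem_comb ?mt1 //;
  exact: line_masks_singular.
Qed.

Lemma collinear_comb (m1 m2 : bitseq) :
  m1 \in singular_masks -> m2 \in singular_masks ->
  collinear (doily_lines c) (comb c m1) (comb c m2) = collinear_masks m1 m2.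
Proof.
move=> m1M m2M; apply/existsP/hasP => [[l /andP[/mem_doily_lines[t tL ->]]]|[t
  tL]].
  have tM := line_masks_singular tL.
  by rewrite !inE !mem_comb //; exists t.
have tM := line_masks_singular tL; rewrite -!(mem_comb tM) // => H.
exists [set x in [seq comb c m | m <- t]]; apply/andP; split.
  by apply/mem_doily_lines; exists t.
by rewrite !inE.
Qed.

Lemma card_doily_points : #|doily_points c| = 15%N.
Proof. by rewrite card_seq_set ?size_map // uniq_comb. Qed.

Lemma card_doily_lines : #|doily_lines c| = 15%N.
Proof. by rewrite card_seq_set ?size_map // uniq_doily_lines. Qed.

(** The axioms hold for masks by computation and are transported by [comb], which is injective on
    singular masks. *)
Lemma is_GQ22_doily : is_GQ22 (doily_points c) (doily_lines c).
Proof.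
rewrite /is_GQ22 card_doily_points card_doily_lines /=; apply/and3P; split.
- apply/forall_inP => _ /mem_doily_lines[t tL ->].
  have tM := line_masks_singular tL.
  rewrite card_seq_set ?uniq_comb ?line_masks_uniq // size_map line_masks_size
    //.
  rewrite eqxx andbT; apply/subsetP => x.
  by rewrite inE => /mapP[m /tM mM ->]; apply/mem_doily_points; exists m.
- apply/forall_inP => _ /mem_doily_points[m mM ->].
  rewrite card_seq_filter ?uniq_doily_lines // count_map -(count_line_masks mM).
  rewrite natn; apply/eqP; apply: eq_in_count => t tL;
    rewrite /= inE mem_comb //.
  exact: line_masks_singular.
apply/forall_inP => _ /mem_doily_points[m mM ->].
apply/forall_inP => _ /mem_doily_lines[t tL ->].
have tM := line_masks_singular tL.
rewrite inE mem_comb //; apply/implyP => /(count_collinear_masks mM tL) count1.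
rewrite card_seq_filter ?uniq_comb ?line_masks_uniq // count_map -[X in _ ==
  X]count1.
by apply/eqP; apply: eq_in_count => m' /tM m'M /=; rewrite collinear_comb.
Qed.

Lemma doily_lines_sub_W : doily_lines c \subset W_lines N.
Proof.
apply/subsetP => _ /mem_doily_lines[t tL ->].
have tM := line_masks_singular tL.
have [m1 [m2 [et m12 s12 p12]]] := line_masksE tL.
have m1M : m1 \in singular_masks by apply: tM; rewrite et !inE eqxx.
have m2M : m2 \in singular_masks by apply: tM; rewrite et !inE eqxx orbT.
apply/imsetP; exists (comb c m1, comb c m2).
  rewrite !inE !comb_neq0 //= (inj_in_eq comb_inj) // m12.
  by have := nonperp_comb m1 m2; rewrite (negbTE p12) => /negbFE.
by apply/setP => x; rewrite et /= !inE comb_xor // -orbA.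
Qed.

Lemma is_doily_of_W_doily : is_doily_of_W (doily_points c) (doily_lines c).
Proof.
rewrite /is_doily_of_W doily_lines_sub_W is_GQ22_doily /=; apply/andP; split.
  by apply/subsetP => _ /mem_doily_points[m mM ->]; rewrite inE comb_neq0.
apply/forall_inP => _ /mem_doily_points[m1 m1M ->].
apply/forall_inP => _ /mem_doily_points[m2 m2M ->].
rewrite (inj_in_eq comb_inj) // collinear_comb //; apply/implyP => m12.
rewrite -[sigma _ _ == 0]negbK -/(nonperp _ _) nonperp_comb.
by rewrite collinear_masksE.
Qed.

Lemma comb_unit_masks : [seq comb c m | m <- unit_masks] = c.
Proof.
move: size_c; case: c => [|x1 [|x2 [|x3 [|x4 [|x5 []]]]]] //= _.
by rewrite /comb /= !big_seq1.
Qed.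

Lemma frame_sub_doily : {subset c <= doily_points c}.
Proof.
rewrite -{1}comb_unit_masks => _ /mapP[m /unit_masks_singular mM ->].
by apply/mem_doily_points; exists m.
Qed.

Lemma span_doily_points : <<enum (doily_points c)>>%VS = <<c>>%VS.
Proof.
apply/eqP; rewrite eqEsubv; apply/andP; split; apply/span_subvP => x.
  rewrite mem_enum => /mem_doily_points[m _ ->].
  by rewrite /comb big_seq; apply: rpred_sum => y /mem_mask; apply: memv_span.
by move=> xc; apply: memv_span; rewrite mem_enum frame_sub_doily.
Qed.

(** The mask of a linear relation among the frame vectors has zero signature, so the only possible
    nontrivial relation is that all five sum to zero. *)
Lemma spans_PG4_doily : spans_PG4 (doily_points c) = (\sum_(x <- c) x != 0).
Proof.
rewrite /spans_PG4 span_doily_points.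
have -> : (\dim <<c>> == 5)%N = free c by rewrite /free size_c.
have comb_true : comb c (nseq 5 true) = \sum_(x <- c) x.
  by rewrite /comb -size_c mask_true.
apply/idP/idP => [|sum0].
  apply: contraTneq => sum0; case: c size_c sum0 => // x s _.
  rewrite big_cons free_cons => /eqP; rewrite addF2_eq0 => /eqP->.
  by rewrite negb_and negbK big_seq rpred_sum // => y; apply: memv_span.
change (is_true (free (in_tuple c))); apply/freeP => k /=; rewrite -comb_scale.
set m := [seq _ | i <- _] => m0.
have size_m : size m = 5%N by rewrite size_map size_enum_ord.
have [||e|e] := @signature_eq0 m _ _ => //.
- apply/negP; rewrite -nonperp_frame_comb m0 => /mapP[x _].
  by rewrite nonperp0r.
- move=> i; apply/eqP/negbFE.
  have : (k i != 0) \in m by apply: map_f; rewrite mem_enum.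
  by rewrite e mem_nseq => /eqP.
by move: m0; rewrite e comb_true => /eqP m0; rewrite m0 in sum0.
Qed.
End Frame.

(** * Frames inside an arbitrary doily *)

Section Doily.

Variables (N : nat) (P : {set vec N}) (L : {set {set vec N}}).
Hypothesis PL_doily : is_doily_of_W P L.

Lemma doily_sub_line (l : {set vec N}) : l \in L -> l \subset P.
Proof.
by case/and4P: PL_doily => _ _ /and5P[_ _ /forall_inP subP _ _] _ /subP/andP[].
Qed.

Lemma doily_lineE (l : {set vec N}) : l \in L ->
  exists a b, [/\ a \in P, b \in P, a != b, ~~ nonperp a b &
                  l = [set a; b; a + b]].
Proof.
move=> lL; have lP := subsetP (doily_sub_line lL).
case/and4P: PL_doily => _ /subsetP/(_ l lL)/imsetP[[a b] /= H el] _ _.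
exists a, b; move: H; rewrite !inE => /and4P[_ _ ab /eqP sab].
by split=> //; [apply: lP| apply: lP |]; rewrite ?el /nonperp ?sab ?negbK ?eqxx
  // !inE eqxx ?orbT.
Qed.

Lemma doily_line_eq (l : {set vec N}) (x y : vec N) :
  l \in L -> x \in l -> y \in l -> x != y -> l = [set x; y; x + y].
Proof.
case/doily_lineE=> a [b [_ _ _ _ ->]]; rewrite !inE -!orbA.
have e1 : b + a = a + b by rewrite addrC.
have e2 : a + (a + b) = b by rewrite addrA addF2xx add0r.
have e3 : a + b + a = b by rewrite addrC e2.
have e4 : b + (a + b) = a by rewrite addrC addF2K.
by case/or3P=> /eqP->; case/or3P=> /eqP->; rewrite ?eqxx ?e1 ?e2 ?e3 ?e4
  ?addF2K // => _;
  apply/setP => z; rewrite !inE;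
  case: (z == a); case: (z == b); case: (z == a + b).
Qed.

Lemma doily_collinear (x y : vec N) : x \in P -> y \in P -> x != y ->
  collinear L x y = ~~ nonperp x y.
Proof.
case/and4P: PL_doily => _ _ _ /forall_inP collP xP yP xy.
by have /forall_inP/(_ y yP)/implyP/(_ xy)/eqP <- := collP x xP; rewrite negbK.
Qed.

Lemma doily_add (x y : vec N) :
  x \in P -> y \in P -> x != y -> ~~ nonperp x y -> x + y \in P.
Proof.
move=> xP yP xy; rewrite -doily_collinear // => /existsP[l /and3P[lL xl yl]].
apply: (subsetP (doily_sub_line lL)).
by rewrite (doily_line_eq lL xl yl xy) !inE eqxx orbT.
Qed.

(* Three lines pass through [p]: some line misses both [q1] and [q2], and the
   point of that line collinear with [q1] (or with [q2]) is [p] itself. *)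
Lemma doily_third_line (p q1 q2 : vec N) :
  p \in P -> q1 \in P -> q2 \in P -> p != q1 -> p != q2 ->
  ~~ nonperp p q1 -> ~~ nonperp p q2 ->
  exists n, [/\ n \in P, ~~ nonperp p n, nonperp n q1 & nonperp n q2].
Proof.
move=> pP q1P q2P pq1 pq2 perp1 perp2.
have [_ _ /and5P[_ _ _ /forall_inP/(_ p pP)/eqP card3 /forall_inP unique] _] :=
  and4P PL_doily.
have [l] : exists l, l \in [set l in L | p \in l]
    :\: [set [set p; q1; p + q1]; [set p; q2; p + q2]].
  apply/set0Pn; rewrite setD_eq0; apply/negP => /subset_leq_card.
  by rewrite card3 cards2; case: (_ != _).
rewrite !inE negb_or => /andP[/andP[l1 l2] /andP[lL pl]].
have off (q : vec N) : q \in P -> p != q -> l != [set p; q;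
  p + q] -> q \notin l.
  by move=> qP pq; apply: contra => ql; rewrite -(doily_line_eq lL pl ql pq).
have [n nl np] : exists2 n, n \in l & p != n.
  have [a [b [_ _ ab _ el]]] := doily_lineE lL.
  case: (eqVneq p a) => [->|pa]; [exists b | exists a];
    rewrite // el !inE eqxx //.
  by rewrite orbT.
have nP : n \in P := subsetP (doily_sub_line lL) n nl.
have nonperp_n (q : vec N) : q \in P -> p != q -> ~~ nonperp p q -> q \notin l
  ->
    nonperp n q.
  move=> qP pq perp ql; apply: contraNT np => perp_n.
  have /forall_inP/(_ l lL)/implyP/(_ ql)/cards1P[x ex] := unique q qP.
  have : p \in [set x] by rewrite -ex inE pl doily_collinear // 1?eq_sym //
    nonperpC.
  have : n \in [set x].
    rewrite -ex inE nl doily_collinear // 1?nonperpC //.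
    by apply: contraNneq ql => ->.
  by rewrite !inE => /eqP-> /eqP->.
exists n; split=> //; try by apply: nonperp_n => //; apply: off.
rewrite -doily_collinear //; apply/existsP; exists l; by rewrite lL pl.
Qed.

(** [P] is closed under adding perpendicular points, so it contains all that the frame generates by
    completing lines. Both sides have 15 points and 15 lines, so inclusions suffice. *)
Lemma doily_generated (c : seq (vec N)) :
  gram nonperp c = cycle_gram -> {subset c <= P} ->
  (doily_points c, doily_lines c) = (P, L).
Proof.
move=> c_gram cP.
have [_ /subsetP LW /and5P[/eqP cardP /eqP cardL _ _ _] _] := and4P PL_doily.
have comb_P (k : nat) (m : bitseq) : m \in iter k line_closure unit_masks ->
    m \in singular_masks /\ comb c m \in P.
  elim: k m => [|k IHk] m.
    move=> mU; split; first exact: unit_masks_singular.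
    by apply: cP; have := map_f (comb c) mU; rewrite comb_unit_masks.
  rewrite iterS mem_cat => /orP[/IHk //|/mapP[[m1 m2]]].
  rewrite mem_filter => /andP[/andP[/= m12 perp]].
  case/allpairsP=> [[a b] [/= aS bS [ea eb]]] ->.
  rewrite -{}ea in aS; rewrite -{}eb in bS.
  have [[m1M m1P] [m2M m2P]] := (IHk _ aS, IHk _ bS).
  have [s12 [t tL et]] := mem_line_masks m1M m2M m12 perp.
  split; first by apply: (line_masks_singular tL); rewrite et !inE eqxx !orbT.
  rewrite comb_xor //; apply: doily_add => //; last by rewrite nonperp_comb.
  by rewrite (inj_in_eq (comb_inj c_gram)).
have eP : doily_points c = P.
  apply/eqP; rewrite eqEcard card_doily_points // cardP natn leqnn andbT.
  apply/subsetP => _ /mem_doily_points[m /line_closure_unit_masks mS ->].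
  by have [] := comb_P _ _ mS.
have eL : L = doily_lines c.
  apply/eqP; rewrite eqEcard card_doily_lines // cardL natn leqnn andbT.
  apply/subsetP => l /doily_lineE[a [b []]].
  rewrite -eP => /mem_doily_points[m1 m1M ea] /mem_doily_points[m2 m2M eb].
  move=> ab perp el.
  have m12 : m1 != m2 by apply: contraNneq ab => e; rewrite ea eb e.
  have [|s12 [t tL et]] := mem_line_masks m1M m2M m12.
    by rewrite -(nonperp_comb c_gram) -ea -eb.
  Show.   apply/mem_doily_lines; exists t => //; apply/setP => z.
  by rewrite [RHS]inE (eq_mem_map _ et) el /= comb_xor // -ea -eb !inE -orbA.
by rewrite eP -eL.
Qed.

Lemma frame_gramE (u1 u2 u3 u4 u5 : vec N) :
  (gram nonperp [:: u1; u2; u3; u4; u5] == cycle_gram) =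
  [&& nonperp u1 u2, ~~ nonperp u1 u3, nonperp u1 u4, ~~ nonperp u1 u5,
      ~~ nonperp u2 u3, ~~ nonperp u2 u4, nonperp u2 u5, nonperp u3 u4,
      nonperp u3 u5 & ~~ nonperp u4 u5].
Proof.
rewrite /gram /= !nonperpxx (nonperpC u2 u1) !(nonperpC u3) !(nonperpC u4)
  !(nonperpC u5).
by do 10![case: (nonperp _ _) => //].
Qed.

(** Starting from perpendicular [a1] and [a2], the other points are found by [doily_third_line]; a
    wrong product is repaired by adding a suitable perpendicular point. *)
Lemma doily_frame : exists u : vec N * vec N * vec N * vec N * vec N,
  {subset seq5 u <= P} /\ gram nonperp (seq5 u) = cycle_gram.
Proof.
have [_ _ /and5P[_ /eqP cardL _ _ _] _] := and4P PL_doily.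
have [l lL] : exists l, l \in L by apply/card_gt0P; rewrite cardL natn.
have [a2 [a1 [a2P a1P a21 p21 _]]] := doily_lineE lL.
have p12 : ~~ nonperp a1 a2 by rewrite nonperpC.
have [a3 [a3P p23 n31 _]] := doily_third_line a2P a1P a1P a21 a21 p21 p21.
have a12 : a1 != a2 by rewrite eq_sym.
have [k [kP p1k nk2 _]] := doily_third_line a1P a2P a2P a12 a12 p12 p12.
(* [k + a1] has the same products as [k] with [a1] and [a2], and the opposite one with [a3]. *)
have [a5 [a5P p15 n52 n53]] : exists a5, [/\ a5 \in P, ~~ nonperp a1 a5,
    nonperp a5 a2 & nonperp a5 a3].
  have [nk3|pk3] := boolP (nonperp k a3); first by exists k.
  exists (k + a1); split.
  - by rewrite doily_add 1?nonperpC //; apply: contraNneq p12 => <-.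
  - by rewrite nonperpDr (negbTE p1k) nonperpxx.
  - by rewrite nonperpDl nk2 (negbTE p12).
  by rewrite nonperpDl (negbTE pk3) nonperpC n31.
(* Using [a1 + a5] makes exactly one of [a1] and [a5] nonperpendicular to [n]. *)
have [n [nP p3n nn2]] : exists n, [/\ n \in P, ~~ nonperp a3 n, nonperp n a2 &
    nonperp n (a1 + a5)].
  apply: doily_third_line => //.
  - by rewrite doily_add //; apply: contraNneq p12 => ->.
  - by apply: contraNneq p21 => <-.
  - apply: contraTneq n31 => ->.
    by rewrite nonperpDl nonperpxx nonperpC (negbTE p15).
  - by rewrite nonperpC.
  by rewrite nonperpDr n31 nonperpC n53.
rewrite nonperpDr => nnw.
(* If that one is [a5], adding [a3] flips the products with [a1] and [a5] and keeps those with [a2]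
   and [a3]. *)
have [a4 [a4P p34 n42 p45 n41]] : exists a4, [/\ a4 \in P, ~~ nonperp a3 a4,
    nonperp a4 a2, ~~ nonperp a4 a5 & nonperp a4 a1].
  have [nn5|pn5] := boolP (nonperp n a5); last first.
    by exists n; split=> //; rewrite (negbTE pn5) addbF in nnw.
  exists (n + a3); rewrite !nonperpDl !nonperpDr nonperpxx nn2 nn5 n31.
  rewrite (negbTE p3n) [nonperp a3 a2]nonperpC (negbTE p23) [nonperp a3
    a5]nonperpC n53.
  rewrite nn5 addbT in nnw; rewrite (negbTE nnw); split=> //.
  rewrite doily_add 1?nonperpC //.
  by apply: contraTneq nn2 => ->; rewrite nonperpC.
(* The 5-cycle is [a1], [a3], [a5], [a2], [a4], labelled 0, 1, 4, 2, 3 as in [cycle_edges]. *)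
exists (a1, a3, a2, a4, a5); split.
  by apply/allP; rewrite /= a1P a2P a3P a4P a5P.
apply/eqP; rewrite /seq5 frame_gramE [nonperp a1 a3]nonperpC n31 p12.
rewrite [nonperp a1 a4]nonperpC n41 p15 [nonperp a3 a2]nonperpC p23 p34.
by rewrite [nonperp a3 a5]nonperpC n53 [nonperp a2 a4]nonperpC n42 [nonperp a2
  a5]nonperpC n52.
Qed.

End Doily.

(** * The number of frames *)

Local Notation vec5 N := (vec N * vec N * vec N * vec N * vec N)%type.

Definition frames (N : nat) : {set vec5 N} :=
  [set u | (gram nonperp (seq5 u) == cycle_gram)
           && (\sum_(x <- seq5 u) x != 0)].

Lemma card_vec (N : nat) : #|{: vec N}| = (2 ^ (N + N))%N.
Proof. by rewrite card_mx mul1n card_Fp. Qed.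

Lemma card_set_neq (T : finType) (R : pzRingType) (A : pred T) (z : T) :
  A z -> #|[set x | A x && (x != z)]|%:R = #|[set x | A x]|%:R - 1 :> R.
Proof.
move=> Az; rewrite (cardsD1 z [set x | A x]) inE Az addnC natrD addrK.
by congr _%:R; apply: eq_card => x; rewrite !inE andbC.
Qed.

Lemma card_frames (N : nat) (q := (2 : rat) ^+ (N + N)) :
  #|frames N|%:R
    = (q - 1) * (q / 2) * (q / 2 / 2 - 1) * (q / 2 / 2 / 2)
      * (q / 2 / 2 / 2 / 2 - 1).
Proof.
have cardT : #|[set x : vec N | true]|%:R = q.
  by rewrite cardsT card_vec natrX.
(* The initial [true] gives all conditions the shape [A x && _] expected by the counting lemmas. *)
pose A1 := [set a : vec N | true && (a != 0)].
pose Q2 (a b : vec N) := true && (nonperp a b == true).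
pose A2 := [set u | (u.1 \in A1) && Q2 u.1 u.2].
pose Q3 (u : vec N * vec N) c :=
  true && (nonperp u.1 c == false) && (nonperp u.2 c == false) && (c != 0).
pose A3 := [set u | (u.1 \in A2) && Q3 u.1 u.2].
pose Q4 (u : vec N * vec N * vec N) d :=
  true && (nonperp u.1.1 d == true) && (nonperp u.1.2 d == false)
  && (nonperp u.2 d == true).
pose A4 := [set u | (u.1 \in A3) && Q4 u.1 u.2].
pose Q5 (u : vec N * vec N * vec N * vec N) e :=
  true && (nonperp u.1.1.1 e == false) && (nonperp u.1.1.2 e == true)
  && (nonperp u.1.2 e == true) && (nonperp u.2 e == false)
  && (e != u.1.1.1 + u.1.1.2 + u.1.2 + u.2).
have -> : frames N = [set u | (u.1 \in A4) && Q5 u.1 u.2].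
  apply/setP => -[[[[a b] c] d] e].
  rewrite !inE /= frame_gramE /Q2 /Q3 /Q4 /Q5 /= !eqb_id !eqbF_neg.
  rewrite !big_cons big_nil addr0 !addrA addF2_eq0 [a + b + c + d == e]eq_sym.
  case ab: (nonperp a b); last by rewrite !andbF.
  case cd: (nonperp c d); last by rewrite !andbF.
  (* Both vectors have a neighbour in the cycle, so they are nonzero; [c != 0] is recorded before
     [d] is chosen because halving by [nonperp c] relies on it. *)
  have -> : a != 0 by apply: (@nonperp_neq0r _ b); rewrite nonperpC.
  have -> : c != 0 by apply: (@nonperp_neq0r _ d); rewrite nonperpC.
  rewrite /=.
  by do 8![case: (nonperp _ _) => //=]; rewrite ?andbT ?andbF.
have half1 (a : vec N) (t : bool) : a != 0 ->
    #|[set x | true && (nonperp a x == t)]|%:R = q / 2.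
  case/nonperp_nondegenerate=> y ay.
  by rewrite (@card_nonperp_half _ _ (fun=> true) a y) ?cardT.
have half2 (a b : vec N) (t1 t2 : bool) : a != 0 -> nonperp a b ->
    #|[set x | true && (nonperp a x == t1) && (nonperp b x == t2)]|%:R
    = q / 2 / 2.
  (* Translation by [a] keeps the product with [a] and flips the one with [b]. *)
  move=> a0 ab; rewrite (@card_nonperp_half _ _
    (fun x => true && (nonperp a x == t1)) b a) ?half1 // 1?nonperpC // => x.
  by rewrite nonperpDr nonperpxx addbF.
have half3 (a b c : vec N) (t1 t2 t3 : bool) : a != 0 -> nonperp a b ->
    nonperp a c = false -> nonperp b c = false -> c != 0 ->
    #|[set x | true && (nonperp a x == t1) && (nonperp b x == t2)
               && (nonperp c x == t3)]|%:R = q / 2 / 2 / 2.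
  move=> a0 ab ac bc /nonperp_nondegenerate[y0 cy0].
  (* Projection of [y0] to the orthogonal of the hyperbolic pair [a], [b]; the product with [c] is
     kept since [c] is orthogonal to both. *)
  pose y := y0 + (if nonperp b y0 then a else 0) + (if nonperp a y0 then b else
    0).
  have [ay by_ cy] : [/\ nonperp a y = false, nonperp b y = false & nonperp c
    y].
    rewrite /y !nonperpDr; split.
    - by case: (nonperp b y0); case: (nonperp a y0);
      rewrite ?nonperpxx ?nonperp0r ?ab.
    - case: (nonperp b y0); case: (nonperp a y0);
      by rewrite ?nonperpxx ?nonperp0r // ?(nonperpC b a) ?ab.
    case: (nonperp b y0); case: (nonperp a y0);
    by rewrite ?nonperp0r ?(nonperpC c a) ?(nonperpC c b) ?ac ?bc cy0.
  clearbody y; rewrite (@card_nonperp_half _ _ (fun x =>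
    true && (nonperp a x == t1)
    && (nonperp b x == t2)) c y) ?half2 // => x.
  by rewrite !nonperpDr ay by_ !addbF.
rewrite (@card_dep_pair _ _ _ A4 Q5 (q / 2 / 2 / 2 / 2 - 1)); last first.
  move=> [[[a b] c] d]; rewrite !inE /Q2 /Q3 /Q4 /= !eqb_id !eqbF_neg.
  case/andP=> /andP[/andP[a0 ab] /andP[/andP[/negbTE ac /negbTE bc] c0]].
  case/andP=> /andP[ad /negbTE bd] cd.
  (* The excluded vector [a + b + c + d] satisfies the four other conditions, the all-ones vector
     being in the radical, so it costs exactly 1. The last halving is by translation along [c]. *)
  rewrite (@card_set_neq _ _ (fun e => true && (nonperp a e == false)
    && (nonperp b e == true) && (nonperp c e == true) && (nonperp d e ==
      false))).
    rewrite (@card_nonperp_half _ _ (fun e => true && (nonperp a e == false)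
      && (nonperp b e == true) && (nonperp c e == true)) d c) ?half3 //.
      by move=> x; rewrite !nonperpDr ac bc nonperpxx !addbF.
    by rewrite nonperpC.
  rewrite !nonperpDr !nonperpxx !(nonperpC d) (nonperpC c a) (nonperpC c b).
  by rewrite (nonperpC b a) ab ac bc ad bd cd.
rewrite (@card_dep_pair _ _ _ A3 Q4 (q / 2 / 2 / 2)); last first.
  move=> [[a b] c]; rewrite !inE /Q2 /Q3 /= !eqb_id !eqbF_neg.
  case/andP=> /andP[a0 ab] /andP[/andP[/negbTE ac /negbTE bc] c0].
  exact: half3.
rewrite (@card_dep_pair _ _ _ A2 Q3 (q / 2 / 2 - 1)); last first.
  move=> [a b]; rewrite !inE /Q2 /= !eqb_id => /andP[a0 ab].
  rewrite (@card_set_neq _ _ (fun c => true && (nonperp a c == false)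
    && (nonperp b c == false))) ?half2 //.
  by rewrite !nonperp0r.
rewrite (@card_dep_pair _ _ _ A1 Q2 (q / 2)); last by move=> a; rewrite inE;
  apply: half1.
by rewrite card_set_neq // cardT.
Qed.

(** * Double counting of frames and quadratic doilies *)

Definition doily_of_frame (N : nat) (u : vec5 N) :=
  (doily_points (seq5 u), doily_lines (seq5 u)).

Lemma doily_of_frame_quadratic (N : nat) (u : vec5 N) :
  u \in frames N -> doily_of_frame u \in quadratic_doilies N.
Proof.
rewrite !inE => /andP[/eqP u_gram sum_u].
by rewrite is_doily_of_W_doily //= spans_PG4_doily.
Qed.

(** A fixed frame [u0] of the doily serves as coordinates: [comb] matches its frames with
    [mask_frames]. *)
Lemma card_frames_of_doily (N : nat) D : D \in quadratic_doilies N ->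
  #|[set u in frames N | doily_of_frame u == D]| = 720%N.
Proof.
case: D => P L; rewrite inE => /= /andP[PL_doily P_span].
have [u0 [u0P u0_gram]] := doily_frame PL_doily.
have [P0 L0] := doily_generated PL_doily u0_gram u0P.
pose c0 := comb (seq5 u0).
pose frame_of (f : seq bitseq) : vec5 N :=
  let x i := c0 (nth [::] f i) in (x 0%N, x 1%N, x 2%N, x 3%N, x 4%N).
have seq5_frame_of f : size f = 5%N -> seq5 (frame_of f) = [seq c0 m | m <- f].
  by case: f => [|f1 [|f2 [|f3 [|f4 [|f5 []]]]]].
have mask_frames_singular f : f \in mask_frames ->
    {subset f <= singular_masks} /\ gram polar f = cycle_gram.
  move=> f_frame; have := mask_frames_size f_frame; move: f_frame.
  case: f => [|f1 [|f2 [|f3 [|f4 [|f5 []]]]]] // + _.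
  by rewrite mem_mask_frames => /andP[/allP ? /eqP].
have -> : [set u in frames N | doily_of_frame u == (P, L)]
    = [set u in [seq frame_of f | f <- mask_frames]].
  apply/setP => u; rewrite in_set [u \in frames N]in_set [RHS]in_set.
  apply/andP/mapP.
    case=> /andP[/eqP u_gram _] /eqP[eP _].
    (* A frame lies in the doily it generates, so its vectors have masks relative to [u0]. *)
    have uP : {subset seq5 u <= P} by rewrite -eP; apply: frame_sub_doily.
    have comb_of x : x \in seq5 u ->
        exists2 m, m \in singular_masks & x = c0 m.
      by move/uP; rewrite -P0 => /mem_doily_points.
    move: u u_gram {eP uP} comb_of => [[[[a b] c] d] e] u_gram comb_of.
    have /comb_of[m1 m1M ea] : a \in seq5 (a, b, c, d, e) by rewrite !inE eqxx.
    have /comb_of[m2 m2M eb] : b \in seq5 (a, b, c, d, e).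
      by rewrite !inE eqxx orbT.
    have /comb_of[m3 m3M ec] : c \in seq5 (a, b, c, d, e).
      by rewrite !inE eqxx !orbT.
    have /comb_of[m4 m4M ed] : d \in seq5 (a, b, c, d, e).
      by rewrite !inE eqxx !orbT.
    have /comb_of[m5 m5M ee] : e \in seq5 (a, b, c, d, e).
      by rewrite !inE eqxx !orbT.
    exists [:: m1; m2; m3; m4; m5]; last by rewrite ea eb ec ed ee.
    rewrite mem_mask_frames /= m1M m2M m3M m4M m5M -u_gram /=.
    by rewrite ea eb ec ed ee /gram /= !nonperp_comb.
  case=> f /[dup] f_frame /mask_frames_singular[fM f_gram] eu.
  have su : seq5 u = [seq c0 m | m <- f].
    by rewrite eu seq5_frame_of // mask_frames_size.
  have u_gram : gram nonperp (seq5 u) = cycle_gram.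
    rewrite su -f_gram /gram -map_comp; apply: eq_map => m /=.
    by rewrite -map_comp; apply: eq_map => m' /=; apply: nonperp_comb.
  have uP : {subset seq5 u <= P}.
    rewrite su -P0 => _ /mapP[m /fM mM ->].
    by apply/mem_doily_points; exists m.
  have eD := doily_generated PL_doily u_gram uP.
  rewrite /doily_of_frame eD eqxx u_gram eqxx; split=> //=.
  (* The nonzero sum comes from the assumption that [P] spans a PG(4,2). *)
  by rewrite -spans_PG4_doily //; case: eD => ->.
rewrite card_seq_set ?size_map ?size_mask_frames //.
rewrite map_inj_in_uniq ?mask_frames_uniq // => f g f_frame g_frame.
move=> /(congr1 (@seq5 _)); rewrite !seq5_frame_of ?mask_frames_size //.
apply: (inj_in_map (comb_inj u0_gram)); rewrite inE; apply/allP.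
  by case/mask_frames_singular: f_frame.
by case/mask_frames_singular: g_frame.
Qed.

Lemma card_quadratic_doilies (N : nat) :
  (#|frames N| = #|quadratic_doilies N| * 720)%N.
Proof.
rewrite -sum1_card (partition_big (@doily_of_frame N) (mem (quadratic_doilies
  N))) /=; last first.
  exact: doily_of_frame_quadratic.
rewrite -sum_nat_const; apply: eq_bigr => D /card_frames_of_doily <-.
by rewrite sum1dep_card.
Qed.

(** * The closed formula *)

Lemma gauss_binom2E (n k : nat) :
  gauss_binom 2 n k
    = \prod_(1 <= i < k.+1) ((2 ^+ n / 2 ^+ k * 2 ^+ i - 1) / (2 ^+ i - 1)).
Proof. by apply: eq_bigr => i _; rewrite !expfzDr // -exprnN. Qed.

Theorem theorem8 (N : nat) (hN : (3 <= N)%N) :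
  (#|quadratic_doilies N|%:R : rat) =
  16 * (gauss_binom 2 (2 * N)%N 5
        - gauss_binom 2 N 5 *
            \prod_(1 <= i < 6) (2 ^ (N%:Z + 1 - i%:Z) + 1)
        - 15 / 3 * 2 ^ (2 * N%:Z - 8) * gauss_binom 2 N 4 *
            \prod_(1 <= i < 5) (2 ^ (N%:Z + 1 - i%:Z) + 1)).
Proof.
have two0 : (2 : rat) != 0 by rewrite pnatr_eq0.
have n720 : (720 : rat) != 0 by rewrite pnatr_eq0.
apply: (mulIf n720); rewrite -natrM -card_quadratic_doilies card_frames.
have expN (i : nat) : (2 : rat) ^ (N%:Z + 1 - i%:Z) = 2 ^+ N * 2 / 2 ^+ i.
  by rewrite (expfzDr _ _ two0) (expfzDr _ _ two0) -exprnN expr1z.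
have -> : (2 : rat) ^ (2 * N%:Z - 8) = 2 ^+ N ^+ 2 / 2 ^+ 8.
  rewrite (expfzDr _ _ two0) -[(- 8)%R]/(- 8%N%:Z) -exprnN -[2 * _]PoszM mulnC.
  by rewrite -exprM.
rewrite !gauss_binom2E [(2 * N)%N]mulnC addnn -muln2 exprM.
(* Every power is now expressed through [2 ^+ N], so the claim is an identity of rational
   expressions in [x]. *)
move: (2 ^+ N) expN => x expN.
rewrite unlock /= !expN.
by field.
Qed.
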